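(* For every sequent $S$, every finite multiset of formulas $\Sigma$, every atom $p$ and every polarity $\circ \in \{+,-\}$ there exist formulas $\forall^{\circ} p\, S$ and $\exists^{\circ} p\, \Sigma$ (one for each such choice of data) such that, writing $\diamond$ for the polarity opposite to $\circ$, the following hold: (var) $\forall^{\circ} p\, S$ and $\exists^{\circ} p\, \Sigma$ are $p^{\circ}$-free, and $V^{\dagger}(\forall^{\circ} p\, S) \subseteq V^{\dagger}(S)$ and $V^{\dagger}(\exists^{\circ} p\, \Sigma) \subseteq V^{\dagger}(\Sigma)$ for every $\dagger \in \{+,-\}$; (i) the sequent $\Sigma \Rightarrow \exists^{\circ} p\, \Sigma$ is derivable in $\mathbf{G4iM}$; (ii) for every sequent $\bar{C} \Rightarrow \bar{D}$ ($\bar D$ containing at most one formula) with $p \notin V^{\circ}(\bar{C} \Rightarrow \bar{D})$, if $\Sigma, \bar{C} \Rightarrow \bar{D}$ is derivable in $\mathbf{G4iM}$, then $\exists^{\circ} p\, \Sigma, \bar{C} \Rightarrow \bar{D}$ is derivable in $\mathbf{G4iM}$; (iii) the sequent $S \cdot (\forall^{\circ} p\, S \Rightarrow)$ is derivable in $\mathbf{G4iM}$; (iv) for every finite multiset $\bar{C}$ with $p \notin V^{\circ}(\bar{C})$, if $S \cdot (\bar{C} \Rightarrow)$ is derivable in $\mathbf{G4iM}$, then $\bar{C}, \exists^{\diamond} p\, S^a \Rightarrow \forall^{\circ} p\, S$ is derivable in $\mathbf{G4iM}$, where $S^a$ is the antecedent of $S$.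
   Context: Formulas are built from atoms $p, q, \dots$ and the constant $\bot$ using $\wedge, \vee, \to$ and the unary modality $\Box$; $\top$ abbreviates $\bot \to \bot$. The positive and negative variables of a formula are defined recursively: $V^+(p)=\{p\}$, $V^-(p)=\varnothing$ for an atom $p$; $V^{\pm}(\bot)=V^{\pm}(\top)=\varnothing$; $V^{\pm}(\phi\wedge\psi)=V^{\pm}(\phi\vee\psi)=V^{\pm}(\phi)\cup V^{\pm}(\psi)$; $V^+(\phi\to\psi)=V^-(\phi)\cup V^+(\psi)$, $V^-(\phi\to\psi)=V^+(\phi)\cup V^-(\psi)$; $V^{\pm}(\Box\phi)=V^{\pm}(\phi)$. For a multiset $\Gamma$, $V^{\dagger}(\Gamma)=\bigcup_{\gamma\in\Gamma}V^{\dagger}(\gamma)$. A formula or multiset $X$ is $p^{\circ}$-free if $p \notin V^{\circ}(X)$. A sequent is an expression $\Gamma \Rightarrow \Delta$ with $\Gamma,\Delta$ finite multisets of formulas, $\Delta$ containing at most one formula; $S^a$ and $S^s$ denote antecedent and succedent of $S$. For a sequent $S$ and $\circ\in\{+,-\}$ with opposite polarity $\diamond$, $V^{\circ}(S)=V^{\diamond}(S^a)\cup V^{\circ}(S^s)$. For sequents $S,T$, $S\cdot T$ is the sequent $(S^a \cup T^a) \Rightarrow (S^s \cup T^s)$ (multiset unions); in particular $S\cdot(\bar C\Rightarrow)$ is $S^a,\bar C \Rightarrow S^s$. The calculus $\mathbf{G4iM}$ (on such sequents; $\Gamma$ a multiset, $\Delta$ a multiset with at most one formula) has axioms $\Gamma,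 p \Rightarrow p$ ($p$ an atom) and $\Gamma,\bot\Rightarrow\Delta$, and rules: $L\wedge$: from $\Gamma,\phi,\psi\Rightarrow\Delta$ infer $\Gamma,\phi\wedge\psi\Rightarrow\Delta$; $R\wedge$: from $\Gamma\Rightarrow\phi$ and $\Gamma\Rightarrow\psi$ infer $\Gamma\Rightarrow\phi\wedge\psi$; $L\vee$: from $\Gamma,\phi\Rightarrow\Delta$ and $\Gamma,\psi\Rightarrow\Delta$ infer $\Gamma,\phi\vee\psi\Rightarrow\Delta$; $R\vee_i$ ($i=0,1$): from $\Gamma\Rightarrow\phi_i$ infer $\Gamma\Rightarrow\phi_0\vee\phi_1$; $Lp{\to}$ ($p$ an atom): from $\Gamma,p,\psi\Rightarrow\Delta$ infer $\Gamma,p,p\to\psi\Rightarrow\Delta$; $L\wedge{\to}$: from $\Gamma,\phi_1\to(\phi_2\to\psi)\Rightarrow\Delta$ infer $\Gamma,(\phi_1\wedge\phi_2)\to\psi\Rightarrow\Delta$; $L\vee{\to}$: from $\Gamma,\phi_1\to\psi,\phi_2\to\psi\Rightarrow\Delta$ infer $\Gamma,(\phi_1\vee\phi_2)\to\psi\Rightarrow\Delta$; $R{\to}$: from $\Gamma,\phi\Rightarrow\psi$ infer $\Gamma\Rightarrow\phi\to\psi$; $L{\to}{\to}$: from $\Gamma,\phi_2\to\psi\Rightarrow\phi_1\to\phi_2$ and $\Gamma,\psi\Rightarrow\Delta$ infer $\Gamma,(\phi_1\to\phi_2)\to\psi\Rightarrow\Delta$; $Lw$: from $\Gamma\Rightarrow\Delta$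 infer $\Gamma,\phi\Rightarrow\Delta$; $Rw$: from $\Gamma\Rightarrow$ infer $\Gamma\Rightarrow\phi$; $M$: from $\phi\Rightarrow\psi$ infer $\Box\phi\Rightarrow\Box\psi$; $LM{\to}$: from $\phi\Rightarrow\psi$ and $\Gamma,\Box\phi,\theta\Rightarrow\Delta$ infer $\Gamma,\Box\phi,\Box\psi\to\theta\Rightarrow\Delta$. *)

(* Defs.v *)
From HB Require Import structures.
From mathcomp Require Import all_boot.
From mathcomp Require Import finmap multiset.

Set Implicit Arguments.
Unset Strict Implicit.
Unset Printing Implicit Defensive.

Local Open Scope fset_scope.
Local Open Scope mset_scope.

Definition atom := nat.

Inductive formula : Type :=
  | Var of atom
  | Bot
  | And of formula & formula
  | Or of formula & formula
  | Imp of formula & formula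
  | Box of formula.

(* {mset formula} needs a choiceType structure on formulas, which is obtained
   by encoding them as generic trees. *)
Fixpoint tree_of_formula (A : formula) : GenTree.tree nat :=
  match A with
  | Var p => GenTree.Leaf p
  | Bot => GenTree.Node 0 [::]
  | And A B => GenTree.Node 1 [:: tree_of_formula A; tree_of_formula B]
  | Or A B => GenTree.Node 2 [:: tree_of_formula A; tree_of_formula B]
  | Imp A B => GenTree.Node 3 [:: tree_of_formula A; tree_of_formula B]
  | Box A => GenTree.Node 4 [:: tree_of_formula A]
  end.

Fixpoint formula_of_tree (t : GenTree.tree nat) : formula :=
  match t with
  | GenTree.Leaf p => Var p
  | GenTree.Node 1 [:: t1; t2] => And (formula_of_tree t1) (formula_of_tree t2)
  | GenTree.Node 2 [:: t1; t2] => Or (formula_of_tree t1) (formula_of_tree t2)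
  | GenTree.Node 3 [:: t1; t2] => Imp (formula_of_tree t1) (formula_of_tree t2)
  | GenTree.Node 4 [:: t1] => Box (formula_of_tree t1)
  | _ => Bot
  end.

Lemma tree_of_formulaK : cancel tree_of_formula formula_of_tree.
Proof. by elim=> //= [A -> B ->|A -> B ->|A -> B ->|A ->]. Qed.

HB.instance Definition _ := Countable.copy formula (can_type tree_of_formulaK).

(* Succedents contain at most one formula, hence the option type. *)
Record sequent := Sequent { ant : {mset formula}; suc : option formula }.

Notation "G =>> D" := (Sequent G D) (at level 70, no associativity).

(* S . (C =>): the only instance of the product of two sequents that is used,
   and one for which the succedent remains a single formula or empty. *)
Definition addant (S : sequent) (C : {mset formula}) : sequent :=
  ant S `+` C =>> suc S.

Inductive polarity := Pos | Neg.

Definition opp (d : polarity) : polarity := if d is Pos then Neg else Pos.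

Fixpoint V (d : polarity) (A : formula) : {fset atom} :=
  match A with
  | Var p => if d is Pos then [fset p] else fset0
  | Bot => fset0
  | And A B | Or A B => (V d A `|` V d B)%fset
  | Imp A B => (V (opp d) A `|` V d B)%fset
  | Box A => V d A
  end.

Definition Vm (d : polarity) (G : {mset formula}) : {fset atom} :=
  (\bigcup_(A <- G) V d A)%fset.

Definition Vs (d : polarity) (S : sequent) : {fset atom} :=
  (Vm (opp d) (ant S) `|` oapp (V d) fset0 (suc S))%fset.

(* A +` G adds one occurrence of A to the multiset G. *)
Inductive G4iM : sequent -> Prop :=
  | G4iM_id G p :
      G4iM (Var p +` G =>> Some (Var p))
  | G4iM_Lbot G D :
      G4iM (Bot +` G =>> D)
  | G4iM_Land G A B D :
      G4iM (A +` (B +` G) =>> D) ->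
      G4iM (And A B +` G =>> D)
  | G4iM_Rand G A B :
      G4iM (G =>> Some A) ->
      G4iM (G =>> Some B) ->
      G4iM (G =>> Some (And A B))
  | G4iM_Lor G A B D :
      G4iM (A +` G =>> D) ->
      G4iM (B +` G =>> D) ->
      G4iM (Or A B +` G =>> D)
  | G4iM_Ror0 G A B :
      G4iM (G =>> Some A) ->
      G4iM (G =>> Some (Or A B))
  | G4iM_Ror1 G A B :
      G4iM (G =>> Some B) ->
      G4iM (G =>> Some (Or A B))
  | G4iM_Lvarimp G p B D :
      G4iM (Var p +` (B +` G) =>> D) ->
      G4iM (Var p +` (Imp (Var p) B +` G) =>> D)
  | G4iM_Landimp G A1 A2 B D :
      G4iM (Imp A1 (Imp A2 B) +` G =>> D) ->
      G4iM (Imp (And A1 A2) B +` G =>> D)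
  | G4iM_Lorimp G A1 A2 B D :
      G4iM (Imp A1 B +` (Imp A2 B +` G) =>> D) ->
      G4iM (Imp (Or A1 A2) B +` G =>> D)
  | G4iM_Rimp G A B :
      G4iM (A +` G =>> Some B) ->
      G4iM (G =>> Some (Imp A B))
  | G4iM_Limpimp G A1 A2 B D :
      G4iM (Imp A2 B +` G =>> Some (Imp A1 A2)) ->
      G4iM (B +` G =>> D) ->
      G4iM (Imp (Imp A1 A2) B +` G =>> D)
  | G4iM_Lw G A D :
      G4iM (G =>> D) ->
      G4iM (A +` G =>> D)
  | G4iM_Rw G A :
      G4iM (G =>> None) ->
      G4iM (G =>> Some A)
  | G4iM_M A B :
      G4iM ([mset A] =>> Some B) ->
      G4iM ([mset Box A] =>> Some (Box B))
  | G4iM_LMimp G A B E D :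
      G4iM ([mset A] =>> Some B) ->
      G4iM (Box A +` (E +` G) =>> D) ->
      G4iM (Box A +` (Imp (Box B) E +` G) =>> D).

(* Main.v *)
(* The calculus is sound and complete for intuitionistic Kripke models with a
   monotone neighbourhood modality, so that entailments between interpolants can
   be checked in models and no cut elimination is needed.  Completeness and the
   interpolants both rest on one analysis ([valid_critical]) of valid sequents
   to which no invertible rule applies.  The interpolants are built by induction
   on the size of the sequent: invertible rules are first used up, after which
   the existential interpolant of [G] is a conjunction, and the universal one of
   [G => D] a disjunction, with one member for each way in which a formula of
   [G] or [D] can be principal. *)

Require Import Defs.
From mathcomp Require Import all_boot.
From mathcomp Require Import finmap multiset zify.
From Stdlib Require Import Classical IndefiniteDescription.

Set Implicit Arguments.
Unset Strict Implicit.
Unset Printing Implicit Defensive.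

Local Open Scope fset_scope.
Local Open Scope mset_scope.
Local Open Scope nat_scope.

(** * Kripke models with neighbourhoods *)

(** Condition (iv) couples the two interpolants. An implication of the context [C] can be used only
    when its antecedent [A] is available, and [A] is [p]-free for the polarity opposite to that of
    [C]; this is what the existential interpolant of opposite polarity supplies. As the antecedent
    [G] changes during the recursion, no fixed choice of that interpolant fits, so a universal
    interpolant is required to work with every formula that satisfies (ii) for [G]. A second
    obstacle is that an implication of [G] may fire through [G] alone or with the help of the
    unknown [C]. Implications whose antecedent [G] already entails are therefore detached
    beforehand, a semantic condition decided classically; what [C] must still contribute is then
    expressed by a single formula, the trigger. *)

Record model := Model {
  world : Type;
  acc : world -> world -> Prop;
  val : world -> atom -> Prop;
  nbh : world -> (world -> Prop) -> Prop;
  acc_refl : forall w, acc w w;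
  acc_trans : forall u v w, acc u v -> acc v w -> acc u w;
  val_acc : forall w v p, acc w v -> val w p -> val v p;
  nbh_acc : forall w v U, acc w v -> nbh w U -> nbh v U;
  nbh_sub : forall w (U U' : world -> Prop),
    (forall v, U v -> U' v) -> nbh w U -> nbh w U'
}.

Fixpoint forces (M : model) (w : world M) (A : formula) : Prop :=
  match A with
  | Var p => val w p
  | Bot => False
  | And A B => forces w A /\ forces w B
  | Or A B => forces w A \/ forces w B
  | Imp A B => forall v, acc w v -> forces v A -> forces v B
  | Box A => nbh w (fun v => forces v A)
  end.

(** Lists stand in for multisets: truth depends on membership alone, while the sizes used below
    count repetitions. *)
Definition forcesl (M : model) (w : world M) (G : seq formula) : Prop :=
  forall A, A \in G -> forces w A.

Definition forceso (M : model) (w : world M) (D : option formula) : Prop :=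
  oapp (forces w) False D.

Definition valid (G : seq formula) (D : option formula) : Prop :=
  forall (M : model) (w : world M), forcesl w G -> forceso w D.

Lemma forces_acc (M : model) (w v : world M) A :
  acc w v -> forces w A -> forces v A.
Proof.
elim: A => [p|//|A IHA B IHB|A IHA B IHB|A _ B _|A _] /= wv.
- exact: val_acc.
- by case=> /(IHA wv) ? /(IHB wv).
- by case=> [/(IHA wv)|/(IHB wv)]; [left|right].
- by move=> h u vu; apply: h; apply: acc_trans vu.
- exact: nbh_acc.
Qed.

Lemma forcesl_acc (M : model) (w v : world M) G :
  acc w v -> forcesl w G -> forcesl v G.
Proof. by move=> wv h A /h; apply: forces_acc. Qed.

Lemma forcesl_cons (M : model) (w : world M) A G :
  forcesl w (A :: G) <-> forces w A /\ forcesl w G.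
Proof.
split=> [h|[hA hG] B]; last by rewrite inE => /orP[/eqP->|/hG].
by split=> [|B BG]; apply: h; rewrite inE ?eqxx ?BG ?orbT.
Qed.

Lemma forcesl_cat (M : model) (w : world M) G H :
  forcesl w (G ++ H) <-> forcesl w G /\ forcesl w H.
Proof.
split=> [h|[hG hH] B]; last by rewrite mem_cat => /orP[/hG|/hH].
by split=> A AG; apply: h; rewrite mem_cat AG ?orbT.
Qed.

Lemma forcesl_rem (M : model) (w : world M) A G :
  A \in G -> forcesl w G <-> forces w A /\ forcesl w (rem A G).
Proof.
move=> AG; rewrite -forcesl_cons; have eqG := perm_mem (perm_to_rem AG).
by split=> h B; [rewrite -eqG|rewrite eqG]; apply: h.
Qed.

Lemma valid_sub G G' D : {subset G <= G'} -> valid G D -> valid G' D.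
Proof. by move=> sGG' GD M w hG'; apply: GD => A /sGG'/hG'. Qed.

Lemma soundness S : G4iM S -> valid (ant S) (suc S).
Proof.
have mcons M (w : world M) A (G : {mset formula}) :
  forcesl w (A +` G) <-> forces w A /\ forcesl w G.
  rewrite -forcesl_cons; split=> h B; have := h B; rewrite in_mset1D inE; exact.
have m1 M (w : world M) A : forcesl w [mset A] <-> forces w A.
  by split=> [|h B]; [apply; rewrite in_mset1|rewrite in_mset1 => /eqP->].
elim=> {S} /=.
- by move=> G p M w /mcons[].
- by move=> G D M w /mcons[].
- move=> G A B D _ IH M w /mcons[[hA hB] hG].
  by apply: IH; apply/mcons; split=> //; apply/mcons.
- by move=> G A B _ IHA _ IHB M w hG; split; [apply: IHA|apply: IHB].
- move=> G A B D _ IHA _ IHB M w /mcons[[hA|hB] hG].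
    by apply: IHA; apply/mcons.
  by apply: IHB; apply/mcons.
- by move=> G A B _ IH M w hG; left; apply: IH.
- by move=> G A B _ IH M w hG; right; apply: IH.
- move=> G p B D _ IH M w /mcons[hp /mcons[hB hG]].
  apply: IH; apply/mcons; split=> //; apply/mcons; split=> //.
  exact: hB (acc_refl w) hp.
- move=> G A1 A2 B D _ IH M w /mcons[h hG]; apply: IH; apply/mcons; split=> //.
  move=> v wv h1 u vu h2; apply: h; first exact: acc_trans vu.
  by split=> //; apply: forces_acc h1.
- move=> G A1 A2 B D _ IH M w /mcons[h hG].
  apply: IH; apply/mcons; split; last (apply/mcons; split=> //).
    by move=> v wv h1; apply: h => //; left.
  by move=> v wv h1; apply: h => //; right.
- move=> G A B _ IH M w hG v wv hA; apply: IH; apply/mcons; split=> //.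
  exact: forcesl_acc hG.
- move=> G A1 A2 B D _ IH1 _ IH2 M w /mcons[h hG].
  apply: IH2; apply/mcons; split=> //; apply: (h _ (acc_refl w)).
  apply: IH1; apply/mcons; split=> // v wv h2; apply: h => // u vu _.
  exact: forces_acc h2.
- by move=> G A D _ IH M w /mcons[_]; apply: IH.
- by move=> G A _ IH M w /IH.
- move=> A B _ IH M w /m1 h; apply: nbh_sub h => v hA; apply: IH.
  exact/m1.
- move=> G A B E D _ IHA _ IH M w /mcons[hA /mcons[hE hG]].
  apply: IH; apply/mcons; split=> //; apply/mcons; split=> //.
  apply: hE (acc_refl w) _; apply: nbh_sub hA => v hA; apply: IHA.
  exact/m1.
Qed.

(** * Gluing countermodels *)

(** [None] is the new root. The index type is arbitrary because one component is glued in for each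
    invalid sequent. *)
Definition glue_world (I : Type) (M : I -> model) : Type :=
  option {i : I & world (M i)}.

(* The root lies below those components whose base point forces [G]; the other
   components are only reached through the neighbourhoods of the root. *)
Definition glue_acc (I : Type) (M : I -> model) (b : forall i, world (M i))
    (G : seq formula) (x y : glue_world M) : Prop :=
  match x with
  | None => y = None \/ exists i v,
      [/\ y = Some (existT _ i v), forcesl (b i) G & acc (b i) v]
  | Some (existT i u) => exists2 v, y = Some (existT _ i v) & acc u v
  end.

Definition glue_val (I : Type) (M : I -> model) (G : seq formula)
    (x : glue_world M) (p : atom) : Prop :=
  match x with
  | None => Var p \in G
  | Some (existT i u) => val u p
  end.

(* Leaving the root out of the neighbourhoods avoids a circular definition. *)
Definition glue_nbh (I : Type) (M : I -> model) (G : seq formula)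
    (x : glue_world M) (U : glue_world M -> Prop) : Prop :=
  match x with
  | None => exists2 A, Box A \in G &
      forall i (v : world (M i)), forces v A -> U (Some (existT _ i v))
  | Some (existT i u) => nbh u (fun v => U (Some (existT _ i v)))
  end.

(** The root takes its atoms and boxes from [G]; persistence holds because every base point that it
    sees forces [G]. *)
Definition glue (I : Type) (M : I -> model) (b : forall i, world (M i))
    (G : seq formula) : model.
Proof.
refine (@Model (glue_world M) (glue_acc b G) (@glue_val I M G)
               (@glue_nbh I M G) _ _ _ _ _).
- case=> [[i u]|] /=; last by left.
  by exists u => //; apply: acc_refl.
- case=> [[i u]|] y z /=.
    by case=> v -> uv [w -> vw]; exists w => //; apply: acc_trans vw.
  case=> [->//|[i [v [-> hb bv]]] [w -> vw]]; right; exists i, w.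
  by split=> //; apply: acc_trans vw.
- case=> [[i u]|] y p /=.
    by case=> v -> uv; apply: val_acc.
  by case=> [->//|[i [v [-> hb bv]]]] /hb /=; apply: val_acc.
- case=> [[i u]|] y U /=.
    by case=> v -> uv; apply: nbh_acc.
  case=> [->//|[i [v [-> hb bv]]]] [A /hb hA hU].
  by apply: (nbh_acc bv); apply: nbh_sub hA => u /hU.
- case=> [[i u]|] U U' UU' /=; first by apply: nbh_sub => v /UU'.
  by case=> A AG hU; exists A => // i v /hU/UU'.
Defined.

(** No world of a component sees outside it, and its neighbourhoods are read off from their trace on
    the component. *)
Lemma forces_glue (I : Type) (M : I -> model) (b : forall i, world (M i)) G i
    (u : world (M i)) A :
  @forces (glue b G) (Some (existT _ i u)) A <-> forces u A.
Proof.
elim: A u => [p|//|A IHA B IHB|A IHA B IHB|A IHA B IHB|A IHA] u //=.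
- by rewrite IHA IHB.
- by rewrite IHA IHB.
- split=> h.
    by move=> v uv /IHA hA; apply/IHB/h => //; exists v.
  by move=> _ [v -> uv] /IHA hA; apply/IHB/h.
- by split; apply: nbh_sub => v /IHA.
Qed.

(** * Critical sequents *)

(** [Imp Bot B] counts as stable: no logical rule decomposes it, and [fires] is false of it. *)
Definition stable (A : formula) : bool :=
  match A with
  | Bot | And _ _ | Or _ _ | Imp (And _ _) _ | Imp (Or _ _) _ => false
  | _ => true
  end.

Definition stable_suc (D : option formula) : bool :=
  if D is Some (And _ _ | Imp _ _) then false else true.

(* The left premise of one of the three non-invertible rules for implications
   on the left, with principal formula [X] and with [H] as the antecedent of its
   conclusion. *)
Definition fires (H : seq formula) (X : formula) : Prop :=
  match X with
  | Imp (Var q) _ => Var q \in H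
  | Imp (Imp A B) C => valid (Imp B C :: rem X H) (Some (Imp A B))
  | Imp (Box A) _ => exists2 B, Box B \in H & valid [:: B] (Some A)
  | _ => False
  end.

(** Only the left or sole premise is recorded; the right premise of an implication rule follows from
    the validity of the conclusion. *)
Inductive critical (H : seq formula) : option formula -> Prop :=
  | critical_id q of Var q \in H : critical H (Some (Var q))
  | critical_imp D A B of Imp A B \in H & fires H (Imp A B) : critical H D
  | critical_or0 A B of valid H (Some A) : critical H (Some (Or A B))
  | critical_or1 A B of valid H (Some B) : critical H (Some (Or A B))
  | critical_box A B of Box A \in H & valid [:: A] (Some B) :
      critical H (Some (Box B)).

(** Choosing pointed countermodels for all invalid sequents at once makes the glued model depend on
    [H] alone. *)
Lemma refuter (i : {s : seq formula * option formula | ~ valid s.1 s.2}) :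
  {m : {M : model & world M} |
    forcesl (projT2 m) (sval i).1 /\ ~ forceso (projT2 m) (sval i).2}.
Proof.
apply: constructive_indefinite_description; case: i => [[G D] /= nv].
apply: NNPP => no; apply: nv => M w hG; apply: NNPP => nD.
by apply: no; exists (existT _ M w).
Qed.

(* If no case of [critical] applies, then countermodels to all invalid sequents
   glued together under a new root yield a countermodel to [H => D]. *)
Lemma valid_critical H D :
  all stable H -> stable_suc D -> valid H D -> critical H D.
Proof.
move=> sH sD vHD; apply: NNPP => ncr.
pose m i := projT1 (sval (refuter i)).
pose b i : world (m i) := projT2 (sval (refuter i)).
have bP i : forcesl (b i) (sval i).1 /\ ~ forceso (b i) (sval i).2.
  exact: svalP (refuter i).
pose r : world (glue b H) := None.
have r_up i : forcesl (b i) H -> @acc (glue b H) r (Some (existT _ i (b i))).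
  by move=> hH; right; exists i, (b i); split=> //; apply: acc_refl.
have rP : forcesl r H.
  move=> X XH; have := allP sH X XH.
  (* Strictly above the root [X] holds because the base points seen there force [H]; only the root
     itself needs an argument. *)
  have above B C : Imp B C = X -> (@forces (glue b H) r B -> fires H X) ->
      @forces (glue b H) r (Imp B C).
    move=> eX hf v [->|[i [u [-> hb bu]]]].
      move=> /hf fX; case: ncr.
      by apply: (@critical_imp H D B C); rewrite eX.
    move/forces_glue=> hB; apply/forces_glue.
    by move: (hb X XH); rewrite -eX => /(_ _ bu hB).
  case: X XH above => [q|//|//|//|B C|B] XH above //=; last first.
    by move=> _; exists B => // i v; move/forces_glue.
  case: B XH above => [q|//|//|//|A1 A2|A] XH above // _;
    apply: (above _ C erefl) => //.
    rewrite /= => hA; apply: NNPP => nf.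
    (* The refuter of [s] forces [A1] and [Imp A2 C], hence [X] and all of [H]. So it lies above the
       root, where [Imp A1 A2] yields [A2]. *)
    pose s := ([:: A1, Imp A2 C & rem (Imp (Imp A1 A2) C) H], Some A2).
    have ns : ~ valid s.1 s.2.
      move=> vs; apply: nf => M w /= hw v wv hA1; apply: vs.
      by apply/forcesl_cons; split=> //; apply: forcesl_acc hw.
    have [/= /forcesl_cons[h1 /forcesl_cons[h2 h3]] h4] := bP (exist _ s ns).
    apply/h4; apply/(forces_glue b H); apply: hA; last exact/forces_glue.
    apply: r_up; apply/(forcesl_rem _ XH); split=> // v bv h.
    by apply: h2 => //; apply: h (acc_refl v) _; apply: forces_acc h1.
  (* The neighbourhoods of the root range over all components, hence also over this refuter, which
     need not force [H]. *)
  case=> B BH hB; exists B => //; apply: NNPP => nv.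
  have [/= h1 h2] := bP (exist _ ([:: B], Some A) nv).
  by apply/h2/(forces_glue b H)/hB/h1; rewrite inE.
have := vHD _ _ rP.
case: D sD vHD ncr => [[q|//|//|A B|//|A]|//] _ vHD ncr /=.
- by move=> hq; apply: ncr; apply: critical_id.
- case=> hA.
    have nv : ~ valid H (Some A).
      by move=> vA; apply: ncr; apply: critical_or0.
    have [/= h1 h2] := bP (exist _ (H, Some A) nv).
    apply/h2/(forces_glue b H); apply: forces_acc hA; exact: r_up.
  have nv : ~ valid H (Some B).
    by move=> vA; apply: ncr; apply: critical_or1.
  have [/= h1 h2] := bP (exist _ (H, Some B) nv).
  by apply/h2/(forces_glue b H); apply: forces_acc hA; exact: r_up.
case=> B BH hB; apply: ncr; apply: (critical_box BH); apply: NNPP => nv.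
have [/= h1 h2] := bP (exist _ ([:: B], Some A) nv).
by apply/h2/(forces_glue b H)/hB/h1; rewrite inE.
Qed.

(** * Completeness *)

(** The extra unit for [And] makes [Imp A (Imp B C)] lighter than [Imp (And A B) C]. *)
Fixpoint weight (A : formula) : nat :=
  match A with
  | Var _ | Bot => 0
  | And A B => (weight A + weight B).+2
  | Or A B | Imp A B => (weight A + weight B).+1
  | Box A => (weight A).+1
  end.

(* Replacing a formula by at most two formulas of smaller [weight] decreases
   the sum of the sizes. *)
Definition size1 (A : formula) : nat := 3 ^ weight A.

Definition sizel (G : seq formula) : nat := sumn (map size1 G).

Definition sizeo (D : option formula) : nat := oapp size1 0 D.

Lemma size1_lt A B : weight A < weight B -> size1 A < size1 B.
Proof. by rewrite ltn_exp2l. Qed.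

(** This fixes the base 3 of [size1]: with base 2, two formulas of weight one below that of [C]
    would add up to exactly the size of [C]. *)
Lemma size1_lt2 A B C :
  weight A < weight C -> weight B < weight C -> size1 A + size1 B < size1 C.
Proof.
rewrite /size1; case: (weight C) => // n; rewrite !ltnS expnS => An Bn.
have := leq_exp2l (weight A) n (isT : 1 < 3).
have := leq_exp2l (weight B) n (isT : 1 < 3).
by rewrite An Bn; have := expn_gt0 3 n; lia.
Qed.

Lemma sizel_cons A G : sizel (A :: G) = size1 A + sizel G.
Proof. by []. Qed.

Lemma sizel_cat G H : sizel (G ++ H) = sizel G + sizel H.
Proof. by rewrite /sizel map_cat sumn_cat. Qed.

Lemma sizel_rem A G : A \in G -> sizel G = size1 A + sizel (rem A G).
Proof.
move=> AG; rewrite -sizel_cons /sizel; apply/perm_sumn/perm_map.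
exact: perm_to_rem.
Qed.

Lemma size_Imp A B : size1 B < size1 (Imp A B).
Proof. by apply: size1_lt; rewrite /=; lia. Qed.

Lemma size_Box A : size1 A < size1 (Box A).
Proof. exact: size1_lt. Qed.

Lemma size_ImpBox A B : size1 A < size1 (Imp (Box A) B).
Proof. by apply: size1_lt; rewrite /=; lia. Qed.

Lemma size_ImpImp A B C :
  size1 (Imp B C) + size1 (Imp A B) < size1 (Imp (Imp A B) C).
Proof. by apply: size1_lt2; rewrite /=; lia. Qed.

(* An unstable formula is equivalent to the disjunction of the conjunctions of
   the lists in its expansion. *)
Definition expand (X : formula) : seq (seq formula) :=
  match X with
  | And A B => [:: [:: A; B]]
  | Or A B => [:: [:: A]; [:: B]]
  | Imp (And A B) C => [:: [:: Imp A (Imp B C)]]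
  | Imp (Or A B) C => [:: [:: Imp A C; Imp B C]]
  | _ => [::]
  end.

Lemma forces_expand (M : model) (w : world M) X : ~~ stable X ->
  forces w X <-> exists2 h, h \in expand X & forcesl w h.
Proof.
have one h : (exists2 h', h' \in [:: h] & forcesl w h') <-> forcesl w h.
  by split=> [[h']|]; [rewrite inE => /eqP->|exists h; rewrite ?inE].
have f1 A : forcesl w [:: A] <-> forces w A.
  by rewrite forcesl_cons; split=> [[]|].
case: X => [//||A B|A B|[//|//|A B|A B|//|//] C|//] // _.
- by split=> // -[].
- by rewrite one forcesl_cons f1.
- rewrite /=; split=> [[hA|hB]|[h]].
  + by exists [:: A]; rewrite ?inE ?eqxx //; apply/f1.
  + by exists [:: B]; rewrite ?inE ?eqxx ?orbT //; apply/f1.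
  + by rewrite !inE => /orP[]/eqP-> /f1; [left|right].
- rewrite one f1 /=; split=> h v wv.
    move=> hA u vu hB; apply: h; first exact: acc_trans vu.
    by split=> //; apply: forces_acc hA.
  by case=> hA hB; apply: h wv hA v (acc_refl v) hB.
- rewrite one forcesl_cons f1 /=; split=> [h|[hA hB] v wv [|]].
  + by split=> v wv hv; apply: h => //; [left|right].
  + exact: hA.
  + exact: hB.
Qed.

Lemma sizel_expand X h : h \in expand X -> sizel h < size1 X.
Proof.
have lt1 A B : weight A < weight B -> sizel [:: A] < size1 B.
  by rewrite /sizel /= addn0; apply: size1_lt.
have lt2 A B C : weight A < weight C -> weight B < weight C ->
    sizel [:: A; B] < size1 C.
  by rewrite /sizel /= addn0; apply: size1_lt2.
case: X => [//||A B|A B|[//|//|A B|A B|//|//] C|//] //=; rewrite !inE.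
- by move/eqP->; apply: lt2; rewrite /=; lia.
- by case/orP=> /eqP->; apply: lt1; rewrite /=; lia.
- by move/eqP->; apply: lt1; rewrite /=; lia.
- by move/eqP->; apply: lt2; rewrite /=; lia.
Qed.

Lemma V_expand X h A d :
  h \in expand X -> A \in h -> (V d A `<=` V d X)%fset.
Proof.
case: X => [//||B C|B C|[//|//|B1 B2|B1 B2|//|//] C|//] //=; rewrite !inE;
  [move/eqP->|case/orP=> /eqP->|move/eqP->|move/eqP->];
  rewrite !inE => H; repeat (case/orP: H => H); move/eqP: H => -> /=;
  by apply/fsubsetP => x; rewrite ?inE; do ?[case/orP]; move=> -> //;
     rewrite ?orbT.
Qed.

(** * Expansion and detachment inside a list *)

Lemma forcesl_expand (M : model) (w : world M) X G :
  X \in G -> ~~ stable X ->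
  forcesl w G <-> exists2 h, h \in expand X & forcesl w (h ++ rem X G).
Proof.
move=> XG uX; split=> [/(forcesl_rem _ XG)[/(forces_expand _ uX)[h hX hh] hG]|].
  by exists h => //; apply/forcesl_cat.
case=> h hX /forcesl_cat[hh hG]; apply/(forcesl_rem _ XG); split=> //.
by apply/forces_expand => //; exists h.
Qed.

Lemma forcesl_detach (M : model) (w : world M) A B G :
  Imp A B \in G -> (forcesl w G -> forces w A) ->
  forcesl w G <-> forcesl w (B :: rem (Imp A B) G).
Proof.
move=> XG vA; split=> [hG|/forcesl_cons[hB hG]].
  have /(forcesl_rem _ XG)[hX hG'] := hG; apply/forcesl_cons; split=> //.
  exact: hX (acc_refl w) (vA hG).
by apply/(forcesl_rem _ XG); split=> // u wu _; apply: forces_acc hB.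
Qed.

Lemma valid_expand G H X D : X \in H -> ~~ stable X ->
  valid (G ++ H) D <->
  forall h, h \in expand X -> valid (G ++ h ++ rem X H) D.
Proof.
move=> XH uX; split=> [v h hX M w|v M w] /forcesl_cat[hG hH].
  apply: v; apply/forcesl_cat; split=> //; apply/(forcesl_expand _ XH uX).
  by exists h.
move/(forcesl_expand _ XH uX): hH => [h hX hH]; apply: (v h hX).
exact/forcesl_cat.
Qed.

Lemma valid_detach G H A B D : Imp A B \in H -> valid (G ++ H) (Some A) ->
  valid (G ++ H) D <-> valid (G ++ B :: rem (Imp A B) H) D.
Proof.
move=> XH vA; split=> v M w /forcesl_cat[hG hH]; apply: v; apply/forcesl_cat;
  split=> //; apply/(forcesl_detach XH) => // hH';
  by apply: vA; apply/forcesl_cat.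
Qed.

Lemma valid_Box G A B :
  Box A \in G -> valid [:: A] (Some B) -> valid G (Some (Box B)).
Proof.
move=> AG v M w hG; apply: nbh_sub (hG _ AG) => u hA; apply: v.
exact/forcesl_cons.
Qed.

(** Since [B] entails [Imp A B], the principal formula entails [Imp B C], so the conclusion has all
    the information of the left premise. *)
Lemma valid_ImpImp G H A B C : Imp (Imp A B) C \in H ->
  valid (G ++ Imp B C :: rem (Imp (Imp A B) C) H) (Some (Imp A B)) ->
  valid (G ++ H) (Some (Imp A B)).
Proof.
move=> XH v M w /forcesl_cat[hG /(forcesl_rem _ XH)[hX hH]] u wu hA.
apply: v (u) _ _ (acc_refl u) hA; apply/forcesl_cat.
split; first exact: forcesl_acc hG.
apply/forcesl_cons; split; last exact: forcesl_acc hH.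
move=> t ut hB; apply: hX; first exact: acc_trans ut.
by move=> s ts _; apply: forces_acc hB.
Qed.

(** This unifies the three implication rules: firing means that the antecedent is already entailed,
    so the right premise arises by detachment. *)
Lemma fires_valid H A B : fires H (Imp A B) -> Imp A B \in H ->
  valid H (Some A).
Proof.
case: A => [q|//|//|//|A1 A2|A] /=.
- by move=> qH _ M w; apply.
- by move=> v XH; apply: (valid_ImpImp (G := [::])) v.
- by case=> C CH v _; apply: valid_Box v.
Qed.

Lemma valid_And G A B :
  valid G (Some (And A B)) <-> valid G (Some A) /\ valid G (Some B).
Proof.
split=> [v|[vA vB] M w hG]; last by split; [apply: vA|apply: vB].
by split=> M w /v[].
Qed.

Lemma valid_Imp G A B : valid G (Some (Imp A B)) <-> valid (A :: G) (Some B).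
Proof.
split=> [v M w /forcesl_cons[hA /v hG]|v M w hG u wu hA].
  by apply: hG hA; apply: acc_refl.
by apply: v; apply/forcesl_cons; split=> //; apply: forcesl_acc hG.
Qed.

(** * Derivations over lists *)

Lemma provable_perm G H D :
  perm_eq G H -> G4iM (seq_mset G =>> D) -> G4iM (seq_mset H =>> D).
Proof. by move/eq_seq_msetP->. Qed.

Lemma seq_mset1 A : seq_mset [:: A] = [mset A] :> {mset formula}.
Proof.
by apply/msetP => B; rewrite mset_seqE msetnE /= addn0 eq_sym; case: eqP.
Qed.

Lemma provable_weak G H D :
  G4iM (G =>> D) -> G4iM (seq_mset H `+` G =>> D).
Proof.
move=> pf; elim: H => [|A H IH]; last first.
  by rewrite mset_cons -msetDA; apply: G4iM_Lw.
suff -> : seq_mset [::] = mset0 :> {mset formula} by rewrite mset0D.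
by apply/msetP=> A; rewrite mset_seqE mset0E.
Qed.

Lemma provable_rem G A D : A \in G ->
  G4iM (A +` seq_mset (rem A G) =>> D) -> G4iM (seq_mset G =>> D).
Proof.
move=> AG; rewrite -mset_cons; apply: provable_perm.
by rewrite perm_sym perm_to_rem.
Qed.

Lemma perm_swap2 (T : eqType) (a b : T) s :
  perm_eq [:: a, b & s] [:: b, a & s].
Proof. exact: permEl (perm_catCA [:: a] [:: b] s). Qed.

(** Backward proof search on valid sequents: invertible rules as long as one applies, then the rule
    named by [valid_critical]. All premises are again valid and smaller. *)
Lemma completeness G D : valid G D -> G4iM (seq_mset G =>> D).
Proof.
have [n] := ubnP (sizel G + sizeo D).
elim: n G D => // n IH G D; rewrite ltnS => le_n v.
have [sG|/allPn[X XG uX]] := boolP (all stable G); last first.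
  apply: (provable_perm (G := X :: rem X G)).
    by rewrite perm_sym perm_to_rem.
  have step h : h \in expand X -> G4iM (seq_mset (h ++ rem X G) =>> D).
    move=> hX; apply: IH; last exact: (valid_expand [::] D XG uX).1 v h hX.
    have := sizel_expand hX; move: le_n; rewrite sizel_cat (sizel_rem XG).
    lia.
  case: X XG uX step => [//||A B|A B|[//|//|A B|A B|//|//] C|//] XG _ step;
    rewrite mset_cons.
  - exact: G4iM_Lbot.
  - apply: G4iM_Land; rewrite -!mset_cons.
    by apply: (step [:: A; B]); rewrite /= !inE eqxx ?orbT.
  - apply: G4iM_Lor; rewrite -!mset_cons.
      by apply: (step [:: A]); rewrite /= !inE eqxx ?orbT.
    by apply: (step [:: B]); rewrite /= !inE eqxx ?orbT.
  - apply: G4iM_Landimp; rewrite -!mset_cons.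
    by apply: (step [:: _]); rewrite /= !inE eqxx ?orbT.
  - apply: G4iM_Lorimp; rewrite -!mset_cons.
    by apply: (step [:: _; _]); rewrite /= !inE eqxx ?orbT.
have [sD|] := boolP (stable_suc D); last first.
  case: D v le_n => [[//|//|A B|//|A B|//]|//] v /= le_n _.
    have /valid_And[vA vB] := v.
    by apply: G4iM_Rand; apply: IH => //=; apply: leq_trans le_n;
       rewrite ltn_add2l; apply: size1_lt; rewrite /=; lia.
  apply: G4iM_Rimp; rewrite -mset_cons; apply: IH; last exact/valid_Imp.
  apply: leq_trans le_n; rewrite sizel_cons /= addnAC addnC ltn_add2l.
  by apply: size1_lt2; rewrite /=; lia.
(* The right premise of each of the three implication rules, up to reordering. *)
have imp_step A B : Imp A B \in G -> valid G (Some A) ->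
    G4iM (seq_mset (B :: rem (Imp A B) G) =>> D).
  move=> XG vA; apply: IH; last exact/(@valid_detach [::] _ _ _ _ XG vA).
  apply: leq_trans le_n; rewrite sizel_cons (sizel_rem XG).
  by have := size_Imp A B; lia.
have cr := valid_critical sG sD v; case: D / cr {sD} v le_n imp_step
  => [q qG|D A B XG fX|A B vA|A B vB|A B AG vB] v le_n imp_step.
- apply: (provable_perm (G := Var q :: rem (Var q) G)).
    by rewrite perm_sym perm_to_rem.
  by rewrite mset_cons; apply: G4iM_id.
- have := imp_step _ _ XG (fires_valid fX XG); have eqG := perm_to_rem XG.
  have rem2 Y : Y != Imp A B -> Y \in G ->
      perm_eq (rem (Imp A B) G) (Y :: rem Y (rem (Imp A B) G)).
    by move=> nY YG; apply/perm_to_rem/rem_mem.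
  case: A XG fX eqG rem2 => [q|//|//|//|A1 A2|A] XG fX eqG rem2.
  + have {rem2} := rem2 (Var q) isT fX; set H := rem (Var q) _ => eqG'.
    move=> pf; apply: (provable_perm (G := [:: Var q, Imp (Var q) B & H])).
      rewrite perm_sym; apply: perm_trans eqG (perm_trans _ (perm_swap2 _ _ _)).
      by rewrite perm_cons.
    rewrite !mset_cons; apply: G4iM_Lvarimp; rewrite -!mset_cons.
    apply: provable_perm pf; apply: perm_trans (perm_swap2 _ _ _).
    by rewrite perm_cons.
  + move=> pf; apply: (provable_rem XG); apply: G4iM_Limpimp;
      rewrite -mset_cons //.
    apply: IH => //; apply: leq_trans le_n; apply: leq_trans (leq_addr _ _).
    by rewrite (sizel_rem XG) sizel_cons addnAC ltn_add2r size_ImpImp.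
  + case: fX => C CG vC; have {rem2} := rem2 (Box C) isT CG.
    set H := rem (Box C) _ => eqG' pf.
    apply: (provable_perm (G := [:: Box C, Imp (Box A) B & H])).
      rewrite perm_sym; apply: perm_trans eqG (perm_trans _ (perm_swap2 _ _ _)).
      by rewrite perm_cons.
    rewrite !mset_cons; apply: G4iM_LMimp.
      rewrite -seq_mset1; apply: IH => //; apply: leq_trans le_n.
      rewrite (sizel_rem XG).
      (* [Box C] and the implication are distinct members of [G], so both sizes are available to
         bound the premise on [C] and [A]. *)
      rewrite (sizel_rem (rem_mem (isT : Box C != Imp (Box A) B) CG)).
      rewrite sizel_cons /= addn0.
      by have := size_Box C; have := size_ImpBox A B; lia.
    rewrite -!mset_cons.
    apply: provable_perm pf; apply: perm_trans (perm_swap2 _ _ _).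
    by rewrite perm_cons.
- apply: G4iM_Ror0; apply: IH => //; apply: leq_trans le_n.
  by rewrite ltn_add2l; apply: size1_lt; rewrite /=; lia.
- apply: G4iM_Ror1; apply: IH => //; apply: leq_trans le_n.
  by rewrite ltn_add2l; apply: size1_lt; rewrite /=; lia.
(* Rule [M] allows no side formulas; the rest of [G] enters by weakening. *)
- apply: (provable_rem AG); rewrite msetDC; apply: provable_weak.
  apply: G4iM_M; rewrite -seq_mset1; apply: IH => //.
  apply: leq_trans le_n; rewrite (sizel_rem AG) /= /sizel /= addn0.
  by have := size_Box A; have := size_Box B; lia.
Qed.

(** * Uniform Lyndon interpolants *)

Definition free (p : atom) (c : polarity) (G : seq formula) : Prop :=
  forall A, A \in G -> p \notin V c A.

Definition freeo (p : atom) (c : polarity) (D : option formula) : Prop :=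
  p \notin oapp (V c) fset0 D.

Definition occurs (d : polarity) (G : seq formula) (x : atom) : Prop :=
  exists2 A, A \in G & x \in V d A.

Definition interpolates (p : atom) (c : polarity) (G : seq formula)
    (e : formula) : Prop :=
  forall C D, free p (opp c) C -> freeo p c D ->
    valid (G ++ C) D -> valid (e :: C) D.

Definition is_exists (p : atom) (c : polarity) (G : seq formula)
    (e : formula) : Prop :=
  [/\ p \notin V c e,
      forall d x, x \in V d e -> occurs d G x,
      valid G (Some e) &
      interpolates p c G e].

(** Besides genuine interpolants, [e] will be [Top] for the empty antecedent and [And e t] after a
    detachment enabled by a trigger [t]. *)
Definition is_forall (p : atom) (c : polarity) (G : seq formula)
    (D : option formula) (a : formula) : Prop :=
  [/\ p \notin V c a,
      forall d x, x \in V d a ->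
        occurs (opp d) G x \/ x \in oapp (V d) fset0 D,
      valid (a :: G) D &
      forall e C, interpolates p (opp c) G e -> free p c C ->
        valid (G ++ C) D -> valid (e :: C) (Some a)].

Lemma oppK : involutive opp.
Proof. by case. Qed.

Definition Top : formula := Imp Bot Bot.

Lemma valid_Top G : valid G (Some Top).
Proof. by move=> M w _ v _ []. Qed.

Lemma V_Top d : V d Top = fset0.
Proof. exact: fsetUid. Qed.

(** Premises of modal rules carry no context, so universal interpolants under a box are taken over
    the empty antecedent and used with this [e]. *)
Lemma interpolates_nil p c : interpolates p c [::] Top.
Proof.
by move=> C D _ _; apply: valid_sub => A CA; rewrite inE CA orbT.
Qed.

Lemma valid_cons_sub A G D : valid G D -> valid (A :: G) D.
Proof. by apply: valid_sub => B BG; rewrite inE BG orbT. Qed.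

Lemma valid_mem G A : A \in G -> valid G (Some A).
Proof. by move=> AG M w; apply. Qed.

(* Finitely many approximations of an interpolant combine to a single one. *)
Lemma collect (T : eqType) (L : seq T) (K : formula -> Prop)
    (Q : T -> formula -> Prop) (op : formula -> formula -> formula) u :
  K u -> (forall x y, K x -> K y -> K (op x y)) ->
  (forall i x y, Q i x \/ Q i y -> Q i (op x y)) ->
  (forall i, i \in L -> exists2 x, K x & Q i x) ->
  exists2 x, K x & forall i, i \in L -> Q i x.
Proof.
move=> Ku Kop Qop; elim: L => [|i L IH] KQ; first by exists u.
have [y Ky Qy] : exists2 x, K x & forall i, i \in L -> Q i x.
  by apply: IH => j jL; apply: KQ; rewrite inE jL orbT.
have [x Kx Qx] := KQ i (mem_head i L).
exists (op x y); first exact: Kop.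
by move=> j; rewrite inE => /orP[/eqP->|/Qy]; auto.
Qed.

(** * Interpolants through invertible rules and detachment *)

Lemma free_expand p c G X h : X \in G -> h \in expand X -> free p c G ->
  free p c (h ++ rem X G).
Proof.
move=> XG hX fG A; rewrite mem_cat => /orP[Ah|/mem_rem/fG//].
by apply: contra (fG X XG) => /(fsubsetP (V_expand c hX Ah)).
Qed.

Lemma free_Imp p c G A B : Imp A B \in G -> free p c G ->
  p \notin V (opp c) A /\ p \notin V c B.
Proof. by move=> XG /(_ _ XG) /=; rewrite inE negb_or => /andP[]. Qed.

Lemma free_detach p c G A B : Imp A B \in G -> free p c G ->
  free p c (B :: rem (Imp A B) G).
Proof.
move=> XG fG C; rewrite inE => /orP[/eqP->|/mem_rem/fG//].
by case: (free_Imp XG fG).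
Qed.

Lemma occurs_expand d G X h x : X \in G -> h \in expand X ->
  occurs d (h ++ rem X G) x -> occurs d G x.
Proof.
move=> XG hX [A]; rewrite mem_cat => /orP[Ah xA|/mem_rem AG xA].
  by exists X => //; apply: (fsubsetP (V_expand d hX Ah)).
by exists A.
Qed.

Lemma occurs_detach d G A B x : Imp A B \in G ->
  occurs d (B :: rem (Imp A B) G) x -> occurs d G x.
Proof.
move=> XG [C]; rewrite inE => /orP[/eqP-> xB|/mem_rem CG xC]; last by exists C.
by exists (Imp A B); rewrite //= inE xB orbT.
Qed.

Lemma occurs_ImpImp d G A B C x : Imp (Imp A B) C \in G ->
  occurs d (Imp B C :: rem (Imp (Imp A B) C) G) x -> occurs d G x.
Proof.
move=> XG [E]; rewrite inE => /orP[/eqP->|/mem_rem EG xE]; last by exists E.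
rewrite /= inE => xBC; exists (Imp (Imp A B) C); rewrite //= !inE.
by case/orP: xBC => ->; rewrite ?orbT.
Qed.

(** [G] is equivalent to the disjunction of the lists [h ++ rem X G], so the disjunction of their
    interpolants serves; for [Bot] it is empty. *)
Lemma is_exists_expand p c G X : X \in G -> ~~ stable X ->
  (forall h, h \in expand X -> exists e, is_exists p c (h ++ rem X G) e) ->
  exists e, is_exists p c G e.
Proof.
move=> XG uX IH.
(* [K] holds what every disjunct must satisfy, [Q] what a single disjunct provides. *)
pose K x := [/\ p \notin V c x, forall d y, y \in V d x -> occurs d G y &
   interpolates p c G x].
pose Q h x := valid (h ++ rem X G) (Some x).
have [|||h hX|x [px vx ux] Qx] := @collect _ (expand X) K Q Or Bot.
- by split=> // C D _ _ _ M w /forcesl_cons[].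
- move=> x y [px vx ux] [py vy uy]; split=> [|d z|C D fC fD v].
  + by rewrite /= inE negb_or px py.
  + by rewrite /= inE => /orP[/vx|/vy].
  + move=> M w /forcesl_cons[[h|h] hC].
      by apply: (ux C D) => //; apply/forcesl_cons.
    by apply: (uy C D) => //; apply/forcesl_cons.
- by move=> h x y [] Qx M w /Qx; [left|right].
- have [e [pe ve ge ue]] := IH h hX; exists e => //; split=> //.
    by move=> d x /ve; apply: occurs_expand.
  move=> C D fC fD v; apply: ue => // M w /forcesl_cat[hh hC]; apply: v.
  apply/forcesl_cat; split=> //; apply/(forcesl_expand _ XG uX).
  by exists h.
exists x; split=> // M w /(forcesl_expand _ XG uX)[h hX]; exact: Qx.
Qed.

Lemma is_exists_detach p c G A B e : Imp A B \in G -> valid G (Some A) ->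
  is_exists p c (B :: rem (Imp A B) G) e -> is_exists p c G e.
Proof.
move=> XG vA [pe ve ge ue]; split=> [//|d x /ve||C D fC fD v].
- exact: occurs_detach.
- by move=> M w hG; apply: ge; apply/(forcesl_detach XG (vA M w)).
- apply: ue => // M w /forcesl_cat[hG hC]; apply: v; apply/forcesl_cat.
  by split=> //; apply/(forcesl_detach XG (vA M w)).
Qed.

Lemma is_forall_detach p c G A B D a : Imp A B \in G -> valid G (Some A) ->
  is_forall p c (B :: rem (Imp A B) G) D a -> is_forall p c G D a.
Proof.
move=> XG vA [pa va ga ua]; split=> [//|d x /va[]||e C ue fC v].
- by move/(occurs_detach XG); left.
- by right.
- move=> M w /forcesl_cons[ha hG]; apply: ga; apply/forcesl_cons; split=> //.
  exact/(forcesl_detach XG (vA M w)).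
have vGB C' D' : valid ((B :: rem (Imp A B) G) ++ C') D' <-> valid (G ++ C') D'.
  split=> v' M w /forcesl_cat[hG hC]; apply: v'; apply/forcesl_cat;
  by split=> //; apply/(forcesl_detach XG (vA M w)).
by apply: ua => // [C' D' fC' fD'|]; rewrite vGB //; apply: ue.
Qed.

Lemma is_forall_valid p c G D : valid G D -> is_forall p c G D Top.
Proof.
move=> v; split=> [|d x||e C _ _ _]; rewrite ?V_Top ?in_fset0 //.
  exact: valid_cons_sub.
exact: valid_Top.
Qed.

(** The branch interpolant [a] is guarded as [Imp e a]: it follows only in the presence of an
    interpolant of the branch, which a given one of [G] need not be. The guard is harmless, since
    the branch entails [e]. *)
Lemma is_forall_expand p c G D X : X \in G -> ~~ stable X ->
  (forall h, h \in expand X ->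
    exists e, is_exists p (opp c) (h ++ rem X G) e) ->
  (forall h, h \in expand X -> exists a, is_forall p c (h ++ rem X G) D a) ->
  exists a, is_forall p c G D a.
Proof.
move=> XG uX IHe IHa.
pose K x := [/\ p \notin V c x,
   forall d y, y \in V d x -> occurs (opp d) G y \/ y \in oapp (V d) fset0 D &
   forall e C, interpolates p (opp c) G e -> free p c C ->
        valid (G ++ C) D -> valid (e :: C) (Some x)].
pose Q h x := valid (x :: h ++ rem X G) D.
have [|||h hX|x [px vx ux] Qx] := @collect _ (expand X) K Q And Top.
- split=> [|d x|e C _ _ _]; rewrite ?V_Top ?in_fset0 //; exact: valid_Top.
- move=> x y [px vx ux] [py vy uy]; split=> [|d z|e C ue fC v].
  + by rewrite /= inE negb_or px py.
  + by rewrite /= inE => /orP[/vx|/vy].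
  + by apply/valid_And; split; [apply: ux|apply: uy].
- move=> h x y QQ M w /forcesl_cons[[hx hy] hh].
  by case: QQ; apply; apply/forcesl_cons.
- have [e [pe ve ge ue]] := IHe h hX; have [a [pa va ga ua]] := IHa h hX.
  exists (Imp e a).
    split=> [|d x|e' C ue' fC v].
    + by rewrite /= inE negb_or pe pa.
    + rewrite /= inE => /orP[/ve|/va[]] H.
      * by left; apply: occurs_expand H.
      * by left; apply: occurs_expand H.
      * by right.
    + apply/valid_Imp; apply: valid_sub (ua e C ue fC _).
        by move=> A; rewrite !inE => /orP[->//|->]; rewrite !orbT.
      move=> M w /forcesl_cat[hh hC]; apply: v; apply/forcesl_cat; split=> //.
      by apply/(forcesl_expand _ XG uX); exists h.
  move=> M w /forcesl_cons[hi hh]; apply: ga; apply/forcesl_cons.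
  by split=> //; apply: (hi w (acc_refl w)); apply: ge.
exists x; split=> // M w /forcesl_cons[hx /(forcesl_expand _ XG uX)[h hX hh]].
by apply: (Qx h hX); apply/forcesl_cons.
Qed.

Lemma is_forall_And p c G A B a b : is_forall p c G (Some A) a ->
  is_forall p c G (Some B) b -> is_forall p c G (Some (And A B)) (And a b).
Proof.
move=> [pa va ga ua] [pb vb gb ub]; split=> [|d x||e C ue fC].
- by rewrite /= inE negb_or pa pb.
- rewrite /= !inE => /orP[/va|/vb] /= [|->]; rewrite ?orbT; by [left|right].
- move=> M w /forcesl_cons[[ha hb] hG].
  by split; [apply: ga|apply: gb]; apply/forcesl_cons.
- by move/valid_And=> [vA vB]; apply/valid_And; split; [apply: ua|apply: ub].
Qed.

(** Guarded for the same reason: an interpolant of [G] need not be one of [A :: G]. *)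
Lemma is_forall_Imp p c G A B e a : is_exists p (opp c) (A :: G) e ->
  is_forall p c (A :: G) (Some B) a ->
  is_forall p c G (Some (Imp A B)) (Imp e a).
Proof.
have occA d x : occurs d (A :: G) x -> x \in V d A \/ occurs d G x.
  by case=> C; rewrite inE => /orP[/eqP->|CG] xC; [left|right; exists C].
move=> [pe ve ge ue] [pa va ga ua]; split=> [|d x||e' C ue' fC v].
- by rewrite /= inE negb_or pe pa.
- rewrite /= !inE => /orP[/ve/occA|/va[/occA|/= ->]].
  + by case=> [->|]; [right|left].
  + by case=> [->|]; [right|left].
  + by right; rewrite orbT.
- move=> M w /forcesl_cons[hi hG] v wv hA.
  have hG' : forcesl v (A :: G).
    by apply/forcesl_cons; split=> //; apply: forcesl_acc hG.
  by apply: ga; apply/forcesl_cons; split=> //; apply: hi => //; apply: ge.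
- apply/valid_Imp; apply: valid_sub (ua e C ue fC _); last exact/valid_Imp.
  by move=> E; rewrite !inE => /orP[->//|->]; rewrite !orbT.
Qed.

(** * Irreducible antecedents and triggers *)

Lemma rem_catl (T : eqType) (x : T) s t :
  x \in s -> rem x (s ++ t) = rem x s ++ t.
Proof.
by elim: s => //= y s IH; rewrite inE eq_sym; case: eqP => //= _ /IH->.
Qed.

Lemma rem_catr (T : eqType) (x : T) s t :
  x \notin s -> rem x (s ++ t) = s ++ rem x t.
Proof.
by elim: s => //= y s IH; rewrite inE negb_or eq_sym => /andP[/negPf-> /IH->].
Qed.

(** By [fires_valid], an implication of such a [G] fires in [G ++ C] only with the help of [C]. *)
Definition irreducible (G : seq formula) : Prop :=
  all stable G /\ forall A B, Imp A B \in G -> ~ valid G (Some A).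

(* [t] is the weakest condition on a context [C] that makes the implication
   [Imp A B] in [G] usable in [G ++ C]. *)
Definition is_trigger (p : atom) (c : polarity) (G : seq formula)
    (A B t : formula) : Prop :=
  [/\ p \notin V c t,
      forall d x, x \in V d t -> occurs (opp d) G x,
      valid (t :: G) (Some A) &
      forall C, free p c C -> fires (G ++ C) (Imp A B) -> valid C (Some t)].

(** By irreducibility a firing atom or box comes from [C]. The trigger is the atom itself, or [Bot]
    if [C] cannot contain it; the box of a universal interpolant; or, for a nested implication, the
    guarded universal interpolant of the left premise. *)
Lemma exists_trigger p c G A B : irreducible G -> Imp A B \in G ->
  (forall c H, sizel H < sizel G -> exists e, is_exists p c H e) ->
  (forall c H D, sizel H + sizeo D < sizel G ->
     exists a, is_forall p c H D a) ->
  exists t, is_trigger p c G A B t.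
Proof.
move=> [sG irr] XG IHe IHa; have nA := irr _ _ XG.
have triv : (forall C, free p c C -> ~ fires (G ++ C) (Imp A B)) ->
    exists t, is_trigger p c G A B t.
  move=> nf; exists Bot; split=> //; first by move=> M w /forcesl_cons[].
  by move=> C fC /nf.
have occ d x : x \in V d A -> occurs (opp d) G x.
  by move=> xA; exists (Imp A B); rewrite //= oppK inE xA.
case: A XG nA triv occ => [q||? ?|? ?|A1 A2|A] XG nA triv occ;
  try by apply: triv => C _ [].
- have [pq|pq] := boolP (p \in V c (Var q)).
    apply: triv => C fC; rewrite /= mem_cat => /orP[qG|/fC].
      by apply: nA; apply: valid_mem.
    by rewrite pq.
  exists (Var q); split=> // [|C fC].
    by apply: valid_mem; rewrite inE eqxx.
  rewrite /= mem_cat => /orP[qG|]; last exact: valid_mem.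
  by case: nA; apply: valid_mem.
- have szX := size_ImpImp A1 A2 B.
  set G' := Imp A2 B :: rem (Imp (Imp A1 A2) B) G.
  have [e [pe ve ge ue]] : exists e, is_exists p (opp c) G' e.
    by apply: IHe; rewrite (sizel_rem XG) sizel_cons; lia.
  have [a [pa va ga ua]] : exists a, is_forall p c G' (Some (Imp A1 A2)) a.
    by apply: IHa; rewrite (sizel_rem XG) sizel_cons addnAC ltn_add2r.
  exists (Imp e a); split=> [|d x||C fC].
  + by rewrite /= inE negb_or pe pa.
  + rewrite /= inE => /orP[/ve|/va[|/occ//]]; exact: occurs_ImpImp.
  + apply/valid_Imp => M w.
    move=> /forcesl_cons[h1 /forcesl_cons[hi /(forcesl_rem _ XG)[hX hG]]].
    have hH : forcesl w G'.
      apply/forcesl_cons; split=> // v wv h2; apply: hX => // u vu _.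
      exact: forces_acc h2.
    apply: (ga M w) (acc_refl w) h1; apply/forcesl_cons; split=> //.
    by apply: (hi w (acc_refl w)); apply: ge.
  + rewrite /= (rem_catl _ XG) => v; apply/valid_Imp.
    exact: ua.
- have szX := size_ImpBox A B.
  have [a [pa va ga ua]] : exists a, is_forall p c [::] (Some A) a.
    by apply: IHa; rewrite (sizel_rem XG); apply: leq_trans szX (leq_addr _ _).
  exists (Box a); split=> [//|d x /va[[]//|/occ//]|M w|C fC].
    move=> /forcesl_cons[ha _]; apply: nbh_sub ha => v ha.
    by apply: ga; apply/forcesl_cons.
  case=> E; rewrite mem_cat => /orP[EG vE|EC vE].
    by case: nA; apply: valid_Box vE.
  move=> M w hC; apply: nbh_sub (hC _ EC) => v hE.
  apply: (ua Top [:: E]) => //.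
  + exact: interpolates_nil.
  + by move=> F; rewrite inE => /eqP->; apply: (fC _ EC).
  + by apply/forcesl_cons; split=> [u _ []|]; apply/forcesl_cons.
Qed.

(** * Existential interpolants of irreducible antecedents *)

(** The clauses for atoms and boxes also cover their use in firing an implication of [C]. *)
Definition exists_clause (p : atom) (c : polarity) (G : seq formula)
    (X x : formula) : Prop :=
  match X with
  | Var q => p \notin V c (Var q) -> valid [:: x] (Some (Var q))
  | Box A => forall B, p \notin V c B -> valid [:: A] (Some B) ->
      valid [:: x] (Some (Box B))
  | Imp A B => forall C D, free p (opp c) C -> freeo p c D ->
      fires (G ++ C) (Imp A B) -> valid (G ++ C) D -> valid (x :: C) D
  | _ => True
  end.

Lemma sizel_detach A B G : Imp A B \in G ->
  sizel (B :: rem (Imp A B) G) < sizel G.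
Proof.
by move=> XG; rewrite (sizel_rem XG) sizel_cons ltn_add2r size_Imp.
Qed.

(** [G] stays fixed: the clauses deal with its formulas, and every other step makes the context
    smaller. *)
Lemma exists_clauses_interpolate p c G e : irreducible G ->
  (forall X, X \in G -> exists_clause p c G X e) -> interpolates p c G e.
Proof.
move=> [sG irr] cl C D; have [n] := ubnP (sizel C + sizeo D).
elim: n C D => // n IH C D; rewrite ltnS => le_n fC fD v.
have [sC|/allPn[X XC uX]] := boolP (all stable C); last first.
  apply/(valid_expand [:: e] D XC uX) => h hX.
  apply: IH; [|exact: free_expand fC|exact: fD|].
    apply: leq_trans le_n; rewrite ltn_add2r (sizel_rem XC) sizel_cat.
    by rewrite ltn_add2r sizel_expand.
  exact: (valid_expand G D XC uX).1 v h hX.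
have [sD|] := boolP (stable_suc D); last first.
  case: D v fD le_n => [[//|//|A B|//|A B|//]|//] v.
    rewrite /freeo /= inE negb_or => /andP[fA fB] le_n _.
    have /valid_And[vA vB] := v.
    by apply/valid_And; split; apply: IH => //; apply: leq_trans le_n;
       rewrite ltn_add2l; apply: size1_lt; rewrite /=; lia.
  rewrite /freeo /= inE negb_or => /andP[fA fB] le_n _.
  apply/valid_Imp; apply: (valid_sub (G := e :: A :: C)).
    by move=> E; rewrite !inE orbCA.
  apply: IH => //.
  - apply: leq_trans le_n; rewrite sizel_cons /= addnAC addnC ltn_add2l.
    by apply: size1_lt2; rewrite /=; lia.
  - by move=> E; rewrite inE => /orP[/eqP->|/fC].
  - move/valid_Imp: v; apply: valid_sub => E.
    by rewrite inE !mem_cat inE orbCA.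
have sGC : all stable (G ++ C) by rewrite all_cat sG.
have cr := valid_critical sGC sD v; case: D / cr {sD} v fD le_n
  => [q qGC|D A B XGC fX|A B vA|A B vB|A B AGC vB] v fD le_n.
- move: qGC; rewrite mem_cat => /orP[qG|qC].
    have vq : valid [:: e] (Some (Var q)) := cl _ qG fD.
    by apply: valid_sub vq => E; rewrite !inE => ->.
  by apply: valid_mem; rewrite inE qC orbT.
- have vA := fires_valid fX XGC.
  (* Membership in [G] is tested first, so that afterwards [rem] acts on [C]. *)
  have [XG|XG] := boolP (Imp A B \in G); first exact: (cl _ XG C D fC fD fX v).
  have XC : Imp A B \in C by move: XGC; rewrite mem_cat (negPf XG).
  have [fA fB] := free_Imp XC fC; rewrite oppK in fA.
  (* The induction hypothesis need not apply to [A] itself, which may be larger than [D]; the firing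
     condition gives [A] directly or through a smaller premise. *)
  have vA' : valid (e :: C) (Some A).
    case: A XG XC fX fA {XGC vA} => [q|//|//|//|A1 A2|A] XG XC fX fA.
    + move: fX; rewrite /= mem_cat => /orP[qG|qC].
        have vq : valid [:: e] (Some (Var q)) := cl _ qG fA.
        by apply: valid_sub vq => E; rewrite !inE => ->.
      by apply: valid_mem; rewrite inE qC orbT.
    + apply: (valid_ImpImp (G := [:: e]) XC); apply: IH => //.
      * apply: leq_trans (leq_trans le_n _) => //.
        rewrite (sizel_rem XC); apply: leq_trans (leq_addr _ _).
        by rewrite sizel_cons addnAC ltn_add2r size_ImpImp.
      * move=> E; rewrite inE => /orP[/eqP->|/mem_rem/fC//].
        move: fA fB; rewrite /= !inE !negb_or oppK => /andP[_ fA'].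
        by rewrite fA'.
      * move: fX; rewrite /= (rem_catr _ XG); apply: valid_sub => E.
        by rewrite inE !mem_cat inE orbCA.
    + case: fX => E; rewrite mem_cat => /orP[EG vE|EC vE].
        have vA : valid [:: e] (Some (Box A)) := cl _ EG A fA vE.
        by apply: valid_sub vA => F; rewrite !inE => ->.
      by apply: valid_cons_sub; apply: valid_Box vE.
  apply/(@valid_detach [:: e] C A B D XC vA'); apply: IH => //.
  + by apply: leq_trans le_n; rewrite ltn_add2r sizel_detach.
  + exact: free_detach.
  + exact/(valid_detach D XC vA).
- move: fD; rewrite /freeo /= inE negb_or => /andP[fA fB].
  have vA' : valid (e :: C) (Some A).
    apply: IH => //; apply: leq_trans le_n.
    by rewrite ltn_add2l; apply: size1_lt; rewrite /=; lia.
  by move=> M w /vA'; left.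
- move: fD; rewrite /freeo /= inE negb_or => /andP[fA fB].
  have vB' : valid (e :: C) (Some B).
    apply: IH => //; apply: leq_trans le_n.
    by rewrite ltn_add2l; apply: size1_lt; rewrite /=; lia.
  by move=> M w /vB'; right.
- move: AGC; rewrite mem_cat => /orP[AG|hC].
    have vB' : valid [:: e] (Some (Box B)) := cl _ AG B fD vB.
    by apply: valid_sub vB' => F; rewrite !inE => ->.
  by apply: valid_cons_sub; apply: valid_Box vB.
Qed.

Lemma is_exists_irreducible p c G : irreducible G ->
  (forall c H, sizel H < sizel G -> exists e, is_exists p c H e) ->
  (forall c H D, sizel H + sizeo D < sizel G ->
     exists a, is_forall p c H D a) ->
  exists e, is_exists p c G e.
Proof.
move=> irr IHe IHa.
pose K x := [/\ p \notin V c x, forall d y, y \in V d x -> occurs d G y &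
  valid G (Some x)].
have KTop : K Top.
  by split=> [|d x|]; rewrite ?V_Top ?in_fset0 //; apply: valid_Top.
have [x y|X x y|X XG|e [pe ve ge] cl] :=
  @collect _ G K (exists_clause p c G) And Top KTop.
- move=> [px vx gx] [py vy gy]; split=> [|d z|].
  + by rewrite /= inE negb_or px py.
  + by rewrite /= inE => /orP[/vx|/vy].
  + exact/valid_And.
- move=> cl; have AndE (H : seq formula) E :
    valid (x :: H) E \/ valid (y :: H) E -> valid (And x y :: H) E.
    move=> v M w /forcesl_cons[[hx hy] hH].
    by case: v; apply; apply/forcesl_cons.
  case: X cl => [q|//|//|//|A B|A] /= cl.
  + by move=> pq; apply: AndE; case: cl => [/(_ pq)|/(_ pq)]; [left|right].
  + move=> C D fC fD fX v; apply: AndE.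
    by case: cl => /(_ C D fC fD fX v); [left|right].
  + move=> B pB v; apply: AndE.
    by case: cl => /(_ B pB v); [left|right].
- case: X XG => [q|||| A B|A] XG; try by exists Top.
  + have [pq|pq] := boolP (p \in V c (Var q)).
      by exists Top => //=; rewrite pq.
    exists (Var q) => [|_]; last by apply: valid_mem; rewrite inE.
    split=> // [d x xq|]; first by exists (Var q).
    exact: valid_mem.
  (* Contexts are here [p]-free for [opp c], which is thus the polarity of the trigger. *)
  + have [t [pt vt gt ut]] := exists_trigger (opp c) irr XG IHe IHa.
    have [e [pe ve ge ue]] := IHe c _ (sizel_detach XG).
    exists (Imp t e); first split=> [|d x|].
    * by rewrite /= inE negb_or pt pe.
    * rewrite /= inE => /orP[/vt|/ve]; first by rewrite oppK.
      exact: occurs_detach.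
    * apply/valid_Imp => M w htG; have /forcesl_cons[_ hG] := htG.
      by apply: ge; apply/(forcesl_detach XG) => // _; apply: gt.
    * move=> C D fC fD fX v; have vt' := ut C fC fX.
      have vX : valid (G ++ C) (Some A).
        by apply: (fires_valid fX); rewrite mem_cat XG.
      have ve' : valid (e :: C) D.
        apply: ue => // M w /forcesl_cat[/forcesl_cons[hB hG] hC].
        apply: v; apply/forcesl_cat; split=> //.
        by apply/(forcesl_rem _ XG); split=> // u wu _; apply: forces_acc hB.
      move=> M w /forcesl_cons[hi hC]; apply: ve'; apply/forcesl_cons.
      by split=> //; apply: hi (acc_refl w) _; apply: vt'.
  + have [e [pe ve ge ue]] : exists e, is_exists p c [:: A] e.
      apply: IHe; rewrite (sizel_rem XG); apply: leq_trans (leq_addr _ _).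
      by rewrite sizel_cons addn0 size_Box.
    exists (Box e); first split=> // [d x /ve[B]|].
    * by rewrite inE => /eqP-> xA; exists (Box A).
    * exact: valid_Box XG ge.
    * move=> B pB v; apply: (@valid_Box _ e); first by rewrite inE.
      by apply: (ue [::] (Some B)).
exists e; split=> //; exact: exists_clauses_interpolate cl.
Qed.

(** * Universal interpolants of irreducible sequents *)

(** Atoms and boxes of [G] ask for nothing: as principal formulas they would make [G => D] valid,
    and their effect on implications of [C] is carried by [e]. *)
Definition forall_clause (p : atom) (c : polarity) (G : seq formula)
    (D : option formula) (X x : formula) : Prop :=
  if X is Imp A B then forall e C, interpolates p (opp c) G e -> free p c C ->
    fires (G ++ C) X -> valid (G ++ C) D -> valid (e :: C) (Some x)
  else True.

Definition forall_suc_clause (p : atom) (c : polarity) (G : seq formula)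
    (D : option formula) (x : formula) : Prop :=
  match D with
  | Some (Var q) => forall C, free p c C -> Var q \in C -> valid C (Some x)
  | Some (Or A B) => forall e C, interpolates p (opp c) G e -> free p c C ->
      valid (G ++ C) (Some A) \/ valid (G ++ C) (Some B) ->
      valid (e :: C) (Some x)
  | Some (Box B) => forall A C, free p c C -> Box A \in C ->
      valid [:: A] (Some B) -> valid C (Some x)
  | _ => True
  end.

Lemma forall_clauses_entailed p c G D x : irreducible G -> stable_suc D ->
  ~ valid G D -> forall_suc_clause p c G D x ->
  (forall X, X \in G -> forall_clause p c G D X x) ->
  forall e C, interpolates p (opp c) G e -> free p c C ->
    valid (G ++ C) D -> valid (e :: C) (Some x).
Proof.
move=> [sG irr] sD nD clD clG e C ue; have [n] := ubnP (sizel C).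
elim: n C => // n IH C; rewrite ltnS => le_n fC v.
have [sC|/allPn[X XC uX]] := boolP (all stable C); last first.
  apply/(valid_expand [:: e] _ XC uX) => h hX.
  apply: IH; [|exact: free_expand fC|].
    apply: leq_trans le_n; rewrite (sizel_rem XC) sizel_cat.
    by rewrite ltn_add2r sizel_expand.
  exact: (valid_expand G D XC uX).1 v h hX.
have sGC : all stable (G ++ C) by rewrite all_cat sG.
have cr := valid_critical sGC sD v; case: D / cr sD v nD clD clG IH
  => [q qGC|D A B XGC fX|A B vA|A B vB|A B AGC vB] sD v nD clD clG IH.
- move: qGC; rewrite mem_cat => /orP[qG|qC].
    by case: nD; apply: valid_mem.
  by apply: valid_cons_sub; apply: clD qC.
- have [XG|XG] := boolP (Imp A B \in G); first exact: (clG _ XG e C ue fC fX v).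
  have XC : Imp A B \in C by move: XGC; rewrite mem_cat (negPf XG).
  have [fA fB] := free_Imp XC fC; have vA := fires_valid fX XGC.
  (* Here the opposite polarity enters: [A] is [p]-free for [opp c], the polarity at which [e]
     interpolates. *)
  have vA' : valid (e :: C) (Some A) by apply: ue => //; rewrite oppK.
  apply/(@valid_detach [:: e] C A B _ XC vA'); apply: IH => //.
  + by apply: leq_trans le_n; rewrite sizel_detach.
  + exact: free_detach.
  + exact/(valid_detach D XC vA).
- by apply: (clD e C ue fC); left.
- by apply: (clD e C ue fC); right.
- move: AGC; rewrite mem_cat => /orP[AG|AC'].
    by case: nD; apply: valid_Box vB.
  by apply: valid_cons_sub; apply: clD AC' vB.
Qed.

Lemma is_forall_irreducible p c G D : irreducible G -> stable_suc D ->
  ~ valid G D ->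
  (forall c H, sizel H < sizel G + sizeo D -> exists e, is_exists p c H e) ->
  (forall c H D', sizel H + sizeo D' < sizel G + sizeo D ->
     exists a, is_forall p c H D' a) ->
  exists a, is_forall p c G D a.
Proof.
move=> irr sD nD IHe IHa.
pose K x := [/\ p \notin V c x,
  forall d y, y \in V d x ->
    occurs (opp d) G y \/ y \in oapp (V d) fset0 D &
  valid (x :: G) D].
have KBot : K Bot by split=> // M w /forcesl_cons[].
have KOr x y : K x -> K y -> K (Or x y).
  move=> [px vx gx] [py vy gy]; split=> [|d z|].
  - by rewrite /= inE negb_or px py.
  - by rewrite /= inE => /orP[/vx|/vy].
  - move=> M w /forcesl_cons[[h|h] hG].
      by apply: gx; apply/forcesl_cons.
    by apply: gy; apply/forcesl_cons.
have OrE H x y :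
  valid H (Some x) \/ valid H (Some y) -> valid H (Some (Or x y)).
  by case=> v M w /v; [left|right].
have [y Ky clD] : exists2 y, K y & forall_suc_clause p c G D y.
  case: D sD nD IHe IHa @K {KBot KOr} => [[q|//|//|A B|//|B]|] 
      sD nD IHe IHa K; try by exists Bot; split=> // M w /forcesl_cons[].
  - have [pq|pq] := boolP (p \in V c (Var q)).
      exists Bot; first by split=> // M w /forcesl_cons[].
      by move=> C fC /fC; rewrite pq.
    exists (Var q); last by move=> C _; apply: valid_mem.
    by split=> // [d x|]; [right|apply: valid_mem; rewrite inE eqxx].
  - have [a [pa va ga ua]] : exists a, is_forall p c G (Some A) a.
      by apply: IHa; rewrite ltn_add2l; apply: size1_lt; rewrite /=; lia.
    have [b [pb vb gb ub]] : exists a, is_forall p c G (Some B) a.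
      by apply: IHa; rewrite ltn_add2l; apply: size1_lt; rewrite /=; lia.
    exists (Or a b); first split=> [|d x|].
    + by rewrite /= inE negb_or pa pb.
    + rewrite /= !inE => /orP[/va|/vb] [|/= ->]; rewrite ?orbT;
      by [left|right].
    + move=> M w /forcesl_cons[[h|h] hG].
        by left; apply: ga; apply/forcesl_cons.
      by right; apply: gb; apply/forcesl_cons.
    + by move=> e C ue fC []; [move/(ua e C ue fC)|move/(ub e C ue fC)];
         move=> v M w /v; [left|right].
  - have [a [pa va ga ua]] : exists a, is_forall p c [::] (Some B) a.
      by apply: IHa; apply: leq_trans (leq_addl _ _); apply: size_Box.
    exists (Box a); first split=> // [d x /va[[]//|]|]; first by right.
      move=> M w /forcesl_cons[ha _]; apply: nbh_sub ha => u ha.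
      by apply: ga; apply/forcesl_cons.
    move=> A C fC AC' v M w /(_ _ AC'); apply: nbh_sub => u hA.
    apply: (ua Top [:: A]) => //.
    + exact: interpolates_nil.
    + by move=> F; rewrite inE => /eqP->; apply: (fC _ AC').
    + by apply/forcesl_cons; split=> [u' _ []|]; apply/forcesl_cons.
have [X x x'|X XG|x Kx clG] :=
  @collect _ G K (forall_clause p c G D) Or Bot KBot KOr.
- case: X => // A B cl e C ue fC fX v; apply: OrE.
  by case: cl => /(_ e C ue fC fX v); [left|right].
- case: X XG => [q|||| A B|A] XG; try by exists Bot.
  have [t [pt vt gt ut]] : exists t, is_trigger p c G A B t.
    apply: (exists_trigger c irr XG) => [c' H lt|c' H D' lt].
      by apply: IHe; apply: leq_trans lt (leq_addr _ _).
    by apply: IHa; apply: leq_trans lt (leq_addr _ _).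
  have [a [pa va ga ua]] : exists a, is_forall p c (B :: rem (Imp A B) G) D a.
    by apply: IHa; rewrite ltn_add2r sizel_detach.
  exists (And t a); first split=> [|d x|].
  + by rewrite /= inE negb_or pt pa.
  + rewrite /= inE => /orP[/vt|/va[]]; [by left| |by right].
    by move/(occurs_detach XG); left.
  + move=> M w /forcesl_cons[[ht ha] hG]; apply: ga; apply/forcesl_cons.
    split=> //; apply/(forcesl_detach XG) => // _; apply: gt.
    exact/forcesl_cons.
  + move=> e C ue fC fX v; have vt' := ut C fC fX.
    have vX : valid (G ++ C) (Some A).
      by apply: (fires_valid fX); rewrite mem_cat XG.
    (* [e] belongs to [G], but [a] was built for the detached list. Adding [t], which is [p]-free
       and may join the context, makes [G] entail that list. *)
    have ue' : interpolates p (opp c) (B :: rem (Imp A B) G) (And e t).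
      move=> C' D' fC' fD' v'.
      have : valid (e :: t :: C') D'.
        apply: ue => // [E|M w /forcesl_cat[hG /forcesl_cons[ht hC]]].
          by rewrite inE oppK => /orP[/eqP->|/fC'] //; rewrite oppK.
        apply: v'; apply/forcesl_cat; split=> //.
        apply/(forcesl_detach XG) => // _; apply: gt; exact/forcesl_cons.
      move=> v'' M w /forcesl_cons[[he ht] hC]; apply: v''.
      by apply/forcesl_cons; split=> //; apply/forcesl_cons.
    have va' : valid (And e t :: C) (Some a).
      apply: ua => // M w /forcesl_cat[/forcesl_cons[hB hG] hC].
      apply: v; apply/forcesl_cat; split=> //.
      by apply/(forcesl_rem _ XG); split=> // u wu _; apply: forces_acc hB.
    move=> M w /forcesl_cons[he hC]; have ht := vt' M w hC.
    by split=> //; apply: va'; apply/forcesl_cons.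
have [px vx gx] := KOr _ _ Ky Kx; exists (Or y x); split=> //.
apply: forall_clauses_entailed => //.
- case: (D) clD => [[q|//|//|A B|//|B]|] //= clD.
  + by move=> C fC qC; apply: OrE; left; apply: clD.
  + by move=> e C ue fC v; apply: OrE; left; apply: clD v.
  + by move=> A C fC AC' v; apply: OrE; left; apply: clD v.
- move=> X /clG; case: X => // A B cl e C ue fC fX v.
  by apply: OrE; right; apply: cl v.
Qed.

(** * The induction on size *)

Lemma unstable_suc_interpolant p c G D : ~~ stable_suc D ->
  (forall c H, sizel H < sizel G + sizeo D -> exists e, is_exists p c H e) ->
  (forall c H D', sizel H + sizeo D' < sizel G + sizeo D ->
     exists a, is_forall p c H D' a) ->
  exists a, is_forall p c G D a.
Proof.
case: D => [[//|//|A B|//|A B|//]|//] _ IHe IHa.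
  have [a ha] : exists a, is_forall p c G (Some A) a.
    by apply: IHa; rewrite ltn_add2l; apply: size1_lt; rewrite /=; lia.
  have [b hb] : exists a, is_forall p c G (Some B) a.
    by apply: IHa; rewrite ltn_add2l; apply: size1_lt; rewrite /=; lia.
  by exists (And a b); apply: is_forall_And.
have lt : sizel (A :: G) + sizeo (Some B) < sizel G + sizeo (Some (Imp A B)).
  rewrite sizel_cons addnAC addnC ltn_add2l.
  by apply: size1_lt2; rewrite /=; lia.
have [e he] := IHe (opp c) _ (leq_ltn_trans (leq_addr _ _) lt).
have [a ha] := IHa c _ _ lt.
by exists (Imp e a); apply: is_forall_Imp.
Qed.

Lemma irreducible_dec G : irreducible G \/
  (exists2 X, X \in G & ~~ stable X) \/
  exists A B, Imp A B \in G /\ valid G (Some A).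
Proof.
have [sG|/allPn[X XG uX]] := boolP (all stable G); last first.
  by right; left; exists X.
case: (classic (exists A B, Imp A B \in G /\ valid G (Some A))) => H.
  by right; right.
by left; split=> // A B XG vA; apply: H; exists A, B.
Qed.

(** Both kinds and both polarities go together: triggers call universal interpolants, whose guards
    are existential ones of opposite polarity. *)
Lemma interpolants p n :
  (forall c G, sizel G < n -> exists e, is_exists p c G e) /\
  (forall c G D, sizel G + sizeo D < n -> exists a, is_forall p c G D a).
Proof.
elim: n => // n [IHe IHa].
have sz_expand G X h : X \in G -> h \in expand X ->
    sizel (h ++ rem X G) < sizel G.
  by move=> XG hX; rewrite (sizel_rem XG) sizel_cat ltn_add2r sizel_expand.
have IHe' c G : sizel G < n.+1 -> exists e, is_exists p c G e.
  rewrite ltnS => le_n.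
  have [irr|[[X XG uX]|[A [B [XG vA]]]]] := irreducible_dec G.
  - apply: is_exists_irreducible irr _ _ => [c' H lt|c' H D lt].
      by apply: IHe; apply: leq_trans lt le_n.
    by apply: IHa; apply: leq_trans lt le_n.
  - apply: (is_exists_expand XG uX) => h hX; apply: IHe.
    exact: leq_trans (sz_expand _ _ _ XG hX) le_n.
  - have [e he] := IHe c _ (leq_trans (sizel_detach XG) le_n).
    by exists e; apply: is_exists_detach he.
split=> // c G D; rewrite ltnS => le_n.
have IHe2 c' H : sizel H < sizel G + sizeo D -> exists e, is_exists p c' H e.
  by move=> lt; apply: IHe; apply: leq_trans lt le_n.
have IHa2 c' H D' : sizel H + sizeo D' < sizel G + sizeo D ->
    exists a, is_forall p c' H D' a.
  by move=> lt; apply: IHa; apply: leq_trans lt le_n.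
have [vD|nD] := classic (valid G D).
  by exists Top; apply: is_forall_valid.
have [sD|uD] := boolP (stable_suc D); last exact: unstable_suc_interpolant.
have [irr|[[X XG uX]|[A [B [XG vA]]]]] := irreducible_dec G.
- exact: is_forall_irreducible.
- apply: (is_forall_expand XG uX) => h hX.
    by apply: IHe2; apply: leq_trans (sz_expand _ _ _ XG hX) (leq_addr _ _).
  by apply: IHa2; rewrite ltn_add2r sz_expand.
- have [a ha] : exists a, is_forall p c (B :: rem (Imp A B) G) D a.
    by apply: IHa2; rewrite ltn_add2r sizel_detach.
  by exists a; apply: is_forall_detach ha.
Qed.

(** * Return to multisets and derivability *)

Lemma G4iM_valid S : G4iM S <-> valid (ant S) (suc S).
Proof.
split=> [|v]; first exact: soundness.
by case: S v => G D v; rewrite -(seq_mset_id G); apply: completeness.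
Qed.

Lemma in_Vm d (G : {mset formula}) x :
  x \in Vm d G <-> occurs d G x.
Proof.
split=> [/bigfcupP[A /andP[AG _] xA]|[A AG xA]]; first by exists A.
by apply/bigfcupP; exists A; rewrite ?AG.
Qed.

Local Open Scope fset_scope.
Local Open Scope mset_scope.

Theorem theorem4p1 :
  exists (Forall : polarity -> atom -> sequent -> formula)
         (Exists : polarity -> atom -> {mset formula} -> formula),
  forall (c : polarity) (p : atom) (S : sequent) (Sigma : {mset formula}),
    (* (var) *)
    (p \notin V c (Forall c p S) /\
     p \notin V c (Exists c p Sigma) /\
     (forall d : polarity,
        (V d (Forall c p S) `<=` Vs d S)%fset /\
        (V d (Exists c p Sigma) `<=` Vm d Sigma)%fset)) /\
    (* (i) *)
    G4iM (Sigma =>> Some (Exists c p Sigma)) /\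
    (* (ii) *)
    (forall (C : {mset formula}) (D : option formula),
       p \notin Vs c (C =>> D) ->
       G4iM (Sigma `+` C =>> D) ->
       G4iM (Exists c p Sigma +` C =>> D)) /\
    (* (iii) *)
    G4iM (addant S [mset Forall c p S]) /\
    (* (iv) *)
    (forall C : {mset formula},
       p \notin Vm c C ->
       G4iM (addant S C) ->
       G4iM (C `+` [mset Exists (opp c) p (ant S)] =>> Some (Forall c p S))).
Proof.
have freeE (p : atom) c (C : {mset formula}) : p \notin Vm c C -> free p c C.
  by move=> pC A AC'; apply: contra pC => pA; apply/in_Vm; exists A.
have exE c p (G : {mset formula}) : {e | is_exists p c G e}.
  apply: constructive_indefinite_description.
  exact: (interpolants p (sizel G).+1).1 c G (leqnn _).
have exA c p S : {a | is_forall p c (ant S) (suc S) a}.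
  apply: constructive_indefinite_description.
  pose n := (sizel (ant S) + sizeo (suc S))%N.
  exact: (interpolants p n.+1).2 c (ant S) (suc S) (leqnn _).
exists (fun c p S => sval (exA c p S)), (fun c p G => sval (exE c p G)).
move=> c p S Sigma /=.
case: (exA c p S) => a /= [pa va ga ua].
case: (exE c p Sigma) => e /= [pe ve ge ue].
(* [e'] was chosen independently of [a]; its interpolation property suffices. *)
case: (exE (opp c) p (ant S)) => e' /= [_ _ _ ue'].
split; first (split=> //; split=> // d; split).
- apply/fsubsetP => x /va[] H; rewrite /Vs inE; last by rewrite H orbT.
  by apply/orP; left; apply/in_Vm.
- by apply/fsubsetP => x /ve H; apply/in_Vm.
split; first exact/G4iM_valid.
split.
  move=> C D; rewrite /Vs inE negb_or => /andP[/freeE fC fD] /G4iM_valid /= v.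
  apply/G4iM_valid => /=; apply: valid_sub (ue C D fC fD _).
    by move=> A; rewrite in_mset1D inE.
  by apply: valid_sub v => A; rewrite in_msetD mem_cat.
split.
  apply/G4iM_valid => /=; apply: valid_sub ga => A.
  by rewrite in_msetD in_mset1 inE orbC.
move=> C /freeE fC /G4iM_valid /= v; apply/G4iM_valid => /=.
apply: valid_sub (ua e' C ue' fC _).
  by move=> A; rewrite in_msetD in_mset1 inE orbC.
by apply: valid_sub v => A; rewrite in_msetD mem_cat.
Qed.
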